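(* Let $0\leq L_{xy}<\infty$, let $I$ be a finite nonempty index set, and let $A_I=\{(x_i,y_i,g^x_i,g^y_i,f_i)\}_{i\in I}$ with $x_i,g^x_i\in\mathbb{R}^{d_x}$, $y_i,g^y_i\in\mathbb{R}^{d_y}$, $f_i\in\mathbb{R}$. For $p\in I$, let $X^p,Y^p,G_x^p,G_y^p$ be the matrices having $\{x_i-x_p\}_{i\in I}$, $\{y_i-y_p\}_{i\in I}$, $\{g^x_i-g^x_p\}_{i\in I}$, $\{g^y_i-g^y_p\}_{i\in I}$ as columns, respectively (in the same order). Then $A_I$ is $\mathcal{S}_{0,0,0,0,L_{xy}}$-interpolable if and only if $$f_i=f_j+\langle g^x_j,x_i-x_j\rangle+\langle g^y_i,y_i-y_j\rangle\quad\text{for all } i,j\in I,$$ and, for all $p\in I$, $$\begin{cases}(G_x^p)^\top G_x^p\preceq L_{xy}^2\,(Y^p)^\top Y^p,\\ (G_y^p)^\top G_y^p\preceq L_{xy}^2\,(X^p)^\top X^p.\end{cases}$$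
   Context: For $0\leq\mu_x\leq L_x$, $0\leq\mu_y\leq L_y$, $L_{xy}\geq 0$, the class $\mathcal{S}_{\mu_x,\mu_y,L_x,L_y,L_{xy}}$ consists of the functions $f:\mathbb{R}^{d_x}\times\mathbb{R}^{d_y}\to\mathbb{R}$ such that $f(\cdot,y)$ is $\mu_x$-strongly convex for every $y$, $f(x,\cdot)$ is $\mu_y$-strongly concave for every $x$ (with $\mu=0$ meaning just convex, respectively concave), the partial gradients exist, and for all arguments $$\|\nabla_x f(x_1,y)-\nabla_x f(x_0,y)\|_2\leq L_x\|x_1-x_0\|_2,\quad \|\nabla_y f(x,y_1)-\nabla_y f(x,y_0)\|_2\leq L_y\|y_1-y_0\|_2,$$ $$\|\nabla_x f(x,y_1)-\nabla_x f(x,y_0)\|_2\leq L_{xy}\|y_1-y_0\|_2,\quad \|\nabla_y f(x_1,y)-\nabla_y f(x_0,y)\|_2\leq L_{xy}\|x_1-x_0\|_2.$$ The class in the claim is the case $\mu_x=\mu_y=L_x=L_y=0$. It consists of the functions $f(x,y)=y^\top A x+a^\top x+b^\top y+c$ with $A\in\mathbb{R}^{d_y\times d_x}$, $\sigma_{\max}(A)\leq L_{xy}$, $a\in\mathbb{R}^{d_x}$, $b\in\mathbb{R}^{d_y}$, $c\in\mathbb{R}$. For a class $\mathcal{C}$ of such functions, $A_I$ is $\mathcal{C}$-interpolable if there exists $f\in\mathcal{C}$ with $g^x_i=\nabla_x f(x_i,y_i)$, $g^y_i=\nabla_y f(x_i,y_i)$, $f_i=f(x_i,y_i)$ for all $i\in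 I$. The symbol $\preceq$ denotes the Loewner order on symmetric matrices. *)

(* Defs.v *)
(* MathComp-Analysis; vectors of R^d are column vectors 'cV[R]_d. *)
From HB Require Import structures.
From mathcomp Require Export all_boot all_order all_algebra.
From mathcomp Require Export all_classical all_reals all_analysis.
Export Order.TTheory GRing.Theory Num.Theory.
Export numFieldNormedType.Exports.

Set Implicit Arguments.
Unset Strict Implicit.
Unset Printing Implicit Defensive.

Local Open Scope classical_set_scope.
Local Open Scope ring_scope.

Section Euclidean.
Variable R : realType.

Definition dotv d (u v : 'cV[R]_d) : R := \sum_(k < d) u k 0 * v k 0.

(* The library's `|u| on matrices is the sup norm. It induces the same
   topology, hence the same differentials, but the Lipschitz constants and
   strong convexity moduli below refer to this Euclidean norm. *)
Definition norm2 d (u : 'cV[R]_d) : R := Num.sqrt (dotv u u).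

(* Only meaningful where f is differentiable. *)
Definition grad d (f : 'cV[R]_d -> R) (x : 'cV[R]_d) : 'cV[R]_d :=
  \col_(k < d) 'd f x (delta_mx k 0 : 'cV[R]_d).

Definition strongly_convex d (mu : R) (f : 'cV[R]_d -> R) : Prop :=
  convex_function [set: 'cV[R]_d] (fun x => f x - mu / 2 * norm2 x ^+ 2).

Definition strongly_concave d (mu : R) (f : 'cV[R]_d -> R) : Prop :=
  strongly_convex mu (fun x => - f x).

Definition psd n (M : 'M[R]_n) : Prop :=
  M^T = M /\ forall v : 'cV[R]_n, 0 <= (v^T *m M *m v) 0 0.

Definition loewner_le n (A B : 'M[R]_n) : Prop := psd (B - A).

End Euclidean.

Section Interpolation.
Variables (R : realType) (dx dy : nat).

Definition gradx (f : 'cV[R]_dx -> 'cV[R]_dy -> R) x y := grad (f^~ y) x.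
Definition grady (f : 'cV[R]_dx -> 'cV[R]_dy -> R) x y := grad (f x) y.

Record in_saddle_class (mux muy Lx Ly Lxy : R)
    (f : 'cV[R]_dx -> 'cV[R]_dy -> R) : Prop := InSaddleClass {
  saddle_convex : forall y, strongly_convex mux (f^~ y) ;
  saddle_concave : forall x, strongly_concave muy (f x) ;
  saddle_diffx : forall x y, differentiable (f^~ y) x ;
  saddle_diffy : forall x y, differentiable (f x) y ;
  saddle_lipxx : forall x0 x1 y,
    norm2 (gradx f x1 y - gradx f x0 y) <= Lx * norm2 (x1 - x0) ;
  saddle_lipyy : forall x y0 y1,
    norm2 (grady f x y1 - grady f x y0) <= Ly * norm2 (y1 - y0) ;
  saddle_lipxy : forall x y0 y1,
    norm2 (gradx f x y1 - gradx f x y0) <= Lxy * norm2 (y1 - y0) ;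
  saddle_lipyx : forall x0 x1 y,
    norm2 (grady f x1 y - grady f x0 y) <= Lxy * norm2 (x1 - x0)
}.

Definition saddle_class (mux muy Lx Ly Lxy : R) :
  set ('cV[R]_dx -> 'cV[R]_dy -> R) :=
  [set f | in_saddle_class mux muy Lx Ly Lxy f].

Definition interpolable (C : set ('cV[R]_dx -> 'cV[R]_dy -> R)) (I : finType)
    (x : I -> 'cV[R]_dx) (y : I -> 'cV[R]_dy)
    (gx : I -> 'cV[R]_dx) (gy : I -> 'cV[R]_dy) (fv : I -> R) : Prop :=
  exists2 f, C f & forall i,
    [/\ gx i = gradx f (x i) (y i), gy i = grady f (x i) (y i)
      & fv i = f (x i) (y i)].

End Interpolation.

(* The columns z_i - z_p, listed in the order of enum I whatever z is. *)
Definition centered_mx (R : realType) d (I : finType) (z : I -> 'cV[R]_d)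
    (p : I) : 'M[R]_(d, #|I|) :=
  \matrix_(k < d, j < #|I|) (z (enum_val j) - z p) k 0.

(* Main.v *)
(** Vanishing L_x and L_y make f affine in each variable, so
    f(x, y) = <x, F y> + <a, x> + <b, y> + c with |F|, |F^T| <= L, and both
    conditions follow.

    Conversely, fix p. The value condition gives X^T Gx = Gy^T Y, and one needs
    F with F Y = Gx, F^T X = Gy and |F| <= L. The last bound says that
    [[L, F], [F^T, L]] is positive semidefinite. Adjoining to it the vectors
    X a and Y b gives a partially specified Gram matrix
      [[L, B, F], [B^T, C, D], [F^T, D^T, L]]
    with B = [L X, Gx], D = [Gy^T; L Y^T] and
    C = [[L X^T X, X^T Gx], [Gx^T X, L Y^T Y]], where only F is unknown. The
    Loewner inequalities say that the two known principal blocks are positive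
    semidefinite. Hence B = B' C and D = C D', and F = B' C D' completes the
    matrix; the interpolation equations follow since X^T B and D Y are
    respectively the first block row and the second block column of C. *)
From HB Require Import structures.
Require Import Defs.
From mathcomp Require Import ring lra.

Set Implicit Arguments.
Unset Strict Implicit.
Unset Printing Implicit Defensive.

Local Open Scope ring_scope.

(** * The Euclidean inner product on column vectors *)

Section Dot.
Variable R : realType.

Lemma dotvE d (u v : 'cV[R]_d) : dotv u v = (u^T *m v) 0 0.
Proof. by rewrite mxE; apply: eq_bigr => k _; rewrite mxE. Qed.

Lemma dotvC d (u v : 'cV[R]_d) : dotv u v = dotv v u.
Proof. by apply: eq_bigr => k _; rewrite mulrC. Qed.

Lemma dotvDr d (u v w : 'cV[R]_d) : dotv u (v + w) = dotv u v + dotv u w.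
Proof. by rewrite !dotvE mulmxDr mxE. Qed.

Lemma dotvDl d (u v w : 'cV[R]_d) : dotv (v + w) u = dotv v u + dotv w u.
Proof. by rewrite dotvC dotvDr !(dotvC u). Qed.

Lemma dotvZr d a (u v : 'cV[R]_d) : dotv u (a *: v) = a * dotv u v.
Proof. by rewrite !dotvE -scalemxAr mxE. Qed.

Lemma dotvZl d a (u v : 'cV[R]_d) : dotv (a *: u) v = a * dotv u v.
Proof. by rewrite dotvC dotvZr dotvC. Qed.

Lemma dotvNr d (u v : 'cV[R]_d) : dotv u (- v) = - dotv u v.
Proof. by rewrite !dotvE mulmxN mxE. Qed.

Lemma dotvNl d (u v : 'cV[R]_d) : dotv (- u) v = - dotv u v.
Proof. by rewrite dotvC dotvNr dotvC. Qed.

Lemma dotv0 d (u : 'cV[R]_d) : dotv u 0 = 0.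
Proof. by rewrite dotvE mulmx0 mxE. Qed.

Lemma dot0v d (u : 'cV[R]_d) : dotv 0 u = 0.
Proof. by rewrite dotvC dotv0. Qed.

Lemma dotv_mulmx m n (M : 'M[R]_(m, n)) u v :
  dotv u (M *m v) = dotv (M^T *m u) v.
Proof. by rewrite !dotvE trmx_mul trmxK mulmxA. Qed.

Lemma dotvv_ge0 d (u : 'cV[R]_d) : 0 <= dotv u u.
Proof. by apply: sumr_ge0 => k _; rewrite -expr2 sqr_ge0. Qed.

Lemma dotvv_eq0 d (u : 'cV[R]_d) : dotv u u <= 0 -> u = 0.
Proof.
move=> u0; have /eqP : dotv u u = 0 by apply/le_anti; rewrite u0 dotvv_ge0.
rewrite psumr_eq0 => [/allP h|k _]; last by rewrite -expr2 sqr_ge0.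
apply/matrixP => k j; rewrite ord1 mxE; apply/eqP.
by have := h k (mem_index_enum k); rewrite mulf_eq0 orbb.
Qed.

Lemma dotv_inj d (u v : 'cV[R]_d) :
  (forall w, dotv u w = dotv v w) -> u = v.
Proof.
move=> uv; apply/eqP; rewrite -subr_eq0; apply/eqP/dotvv_eq0.
by rewrite {1}dotvDl dotvNl uv subrr.
Qed.

Lemma dotv_delta d (u : 'cV[R]_d) k : dotv u (delta_mx k 0) = u k 0.
Proof. by rewrite dotvE -colE !mxE. Qed.

Lemma dotv_col_mx m n (u v : 'cV[R]_m) (u' v' : 'cV[R]_n) :
  dotv (col_mx u u') (col_mx v v') = dotv u v + dotv u' v'.
Proof. by rewrite !dotvE tr_col_mx mul_row_col mxE. Qed.

Lemma norm2_ge0 d (u : 'cV[R]_d) : 0 <= norm2 u.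
Proof. exact: sqrtr_ge0. Qed.

Lemma norm2_le d e L (u : 'cV[R]_d) (v : 'cV[R]_e) : 0 <= L ->
  (norm2 u <= L * norm2 v) = (dotv u u <= L ^+ 2 * dotv v v).
Proof.
move=> L0; rewrite -[RHS]ler_sqrt ?mulr_ge0 ?sqr_ge0 ?dotvv_ge0 //.
by rewrite sqrtrM ?sqr_ge0 // sqrtr_sqr ger0_norm.
Qed.

(** Shaped to consume a Lipschitz bound with constant 0. *)
Lemma norm2_le0 d (u : 'cV[R]_d) a : norm2 u <= 0 * a -> u = 0.
Proof.
rewrite mul0r => u0; apply: dotvv_eq0.
by rewrite -[dotv u u]sqr_sqrtr ?dotvv_ge0 // -[Num.sqrt _]/(norm2 u)
  (le_anti (_ : norm2 u <= 0 <= _)) ?expr0n // u0 norm2_ge0.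
Qed.

(** * Positive semidefinite block matrices and their completion *)

Lemma psd_gram m n k L (A : 'M[R]_(m, k)) (B : 'M[R]_(n, k)) :
  loewner_le (A^T *m A) (L *: (B^T *m B)) <->
  forall v, dotv (A *m v) (A *m v) <= L * dotv (B *m v) (B *m v).
Proof.
have E v : (v^T *m (L *: (B^T *m B) - A^T *m A) *m v) 0 0 =
    L * dotv (B *m v) (B *m v) - dotv (A *m v) (A *m v).
  by rewrite mulmxBr mulmxBl -scalemxAr -scalemxAl !dotvE !trmx_mul !mulmxA !mxE.
split=> [[_ h] v|h]; first by rewrite -subr_ge0 -E.
split=> [|v]; last by rewrite E subr_ge0.
by rewrite linearB linearZ /= !trmx_mul !trmxK.
Qed.

(** It suffices that B kills every v with C v = 0. For such v, put u = B v: the form at (t u, -v) is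
    a t^2 - 2 t |u|^2, which is nonnegative for all t only if u = 0. *)
Lemma psd_block_range m n (A : 'M[R]_m) (B : 'M[R]_(m, n)) (C : 'M[R]_n) :
  (forall u v, 0 <= dotv u (A *m u) + 2 * dotv u (B *m v) + dotv v (C *m v)) ->
  exists B', B = B' *m C.
Proof.
move=> psd; suff /submxP[B' ->] : (B <= C)%MS by exists B'.
rewrite submxE; apply/eqP/matrixP => i k.
set v := col k (cokermx C); set u := B *m v.
have Cv : C *m v = 0 by rewrite /v colE mulmxA mulmx_coker mul0mx.
suff u0 : u = 0.
  have := congr1 (fun M : 'cV_m => M i 0) u0.
  by rewrite /u /v colE mulmxA -colE !mxE.
apply: dotvv_eq0; set c := dotv u u; pose a := dotv u (A *m u).
have h t : 0 <= a * t ^+ 2 - 2 * t * c.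
  have := psd (t *: u) (- v).
  rewrite !mulmxN Cv oppr0 dotv0 addr0 -/u -scalemxAr !(dotvZl, dotvZr) dotvNr.
  by rewrite -/a -/c; congr (0 <= _); ring.
have c0 : 0 <= c := dotvv_ge0 u.
have a0 : 0 <= a by have := psd u 0; rewrite !mulmx0 !dotv0 -/a; lra.
rewrite leNgt; apply/negP => cp.
have ap : 0 < a + 1 by lra.
(* The minimizer c / a is shifted to c / (a + 1), since a may vanish; the value there is still
   negative. *)
have := h (c / (a + 1)).
have -> : a * (c / (a + 1)) ^+ 2 - 2 * (c / (a + 1)) * c =
   - (c ^+ 2 * (a + 2)) / (a + 1) ^+ 2 by field; rewrite gt_eqF.
rewrite mulNr oppr_ge0 leNgt => /negP; apply.
by rewrite divr_gt0 ?mulr_gt0 ?exprn_gt0 //; lra.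
Qed.

(** The new corner pairs [B'^T *m u] with [D' *m w] under the form of C, so C is never inverted. *)
Lemma psd_completion m n k (A : 'M[R]_m) (B : 'M[R]_(m, n)) (C : 'M[R]_n)
    (D : 'M[R]_(n, k)) (E : 'M[R]_k) : C^T = C ->
  (forall u v, 0 <= dotv u (A *m u) + 2 * dotv u (B *m v) + dotv v (C *m v)) ->
  (forall w v, 0 <= dotv w (E *m w) + 2 * dotv w (D^T *m v) + dotv v (C *m v)) ->
  exists B' D', [/\ B = B' *m C, D = C *m D' &
    forall u w, 0 <= dotv u (A *m u) + 2 * dotv u (B' *m C *m D' *m w)
                     + dotv w (E *m w)].
Proof.
move=> symC psdB psdD.
have [B' BE] := psd_block_range psdB; have [D'' DE] := psd_block_range psdD.
have {}DE : D = C *m D''^T by rewrite -[D]trmxK DE trmx_mul symC.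
exists B', D''^T; split=> // u w.
set D' := D''^T in DE *.
have Csym a b : dotv a (C *m b) = dotv b (C *m a).
  by rewrite dotv_mulmx symC dotvC.
set b := B'^T *m u; set d := D' *m w.
have psdC : 0 <= dotv (b + d) (C *m (b + d)).
  by have := psdB 0 (b + d); rewrite !dot0v mulr0 !add0r.
(* The completed form at [(u, 0, w)] is the sum of the form of [psdB] at
   [(u, - b)], that of [psdD] at [(w, - d)], and the form of C at [b + d]. *)
have := psdB u (- b); have := psdD w (- d); move: psdC.
have -> : dotv u (B *m - b) = - dotv b (C *m b).
  by rewrite BE mulmxN dotvNr -mulmxA [dotv u _]dotv_mulmx.
have -> : dotv w (D^T *m - d) = - dotv d (C *m d).
  by rewrite DE mulmxN dotvNr trmx_mul symC -mulmxA [dotv w _]dotv_mulmx trmxK.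
have -> : dotv u (B' *m C *m D' *m w) = dotv b (C *m d).
  by rewrite -!mulmxA dotv_mulmx.
rewrite !mulmxN !mulmxDr !(dotvNl, dotvNr, dotvDl, dotvDr) (Csym d b); lra.
Qed.

(** Multiplied by L > 0, the expression is at least |L z + g|^2; if L = 0, then g = 0. This is what
    makes both known principal blocks semidefinite. *)
Lemma dotv_perturb_ge0 d e (L : R) (z g : 'cV[R]_d) (y : 'cV[R]_e) :
  0 <= L -> dotv g g <= L ^+ 2 * dotv y y ->
  0 <= L * dotv z z + 2 * dotv z g + L * dotv y y.
Proof.
rewrite le_eqVlt => /predU1P[<-|L0] gy.
  rewrite (_ : g = 0) ?dotv0 //; first by rewrite !mul0r mulr0 !addr0.
  by apply: dotvv_eq0; move: gy; rewrite expr0n mul0r.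
rewrite -(pmulr_rge0 _ L0).
have := dotvv_ge0 (L *: z + g).
rewrite !(dotvDl, dotvDr, dotvZl, dotvZr) (dotvC g z).
set a := dotv z z; set b := dotv z g; lra.
Qed.

Lemma operator_interpolation dx dy n (L : R) (X Gx : 'M[R]_(dx, n))
    (Y Gy : 'M[R]_(dy, n)) : 0 <= L -> X^T *m Gx = Gy^T *m Y ->
  (forall v, dotv (Gx *m v) (Gx *m v) <= L ^+ 2 * dotv (Y *m v) (Y *m v)) ->
  (forall v, dotv (Gy *m v) (Gy *m v) <= L ^+ 2 * dotv (X *m v) (X *m v)) ->
  exists F : 'M[R]_(dx, dy), [/\ F *m Y = Gx, F^T *m X = Gy,
    forall w, dotv (F *m w) (F *m w) <= L ^+ 2 * dotv w w &
    forall u, dotv (F^T *m u) (F^T *m u) <= L ^+ 2 * dotv u u].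
Proof.
move=> L0 XG hGx hGy.
have GX : Gx^T *m X = Y^T *m Gy by apply: trmx_inj; rewrite !trmx_mul !trmxK XG.
pose C := block_mx (L *: (X^T *m X)) (X^T *m Gx) (Gx^T *m X) (L *: (Y^T *m Y)).
pose B := row_mx (L *: X) Gx; pose D := col_mx Gy^T (L *: Y^T).
have symC : C^T = C.
  by rewrite tr_block_mx !linearZ /= !trmx_mul !trmxK.
have Cquad a b : dotv (col_mx a b) (C *m col_mx a b) =
    L * dotv (X *m a) (X *m a) + 2 * dotv (X *m a) (Gx *m b)
    + L * dotv (Y *m b) (Y *m b).
  rewrite mul_block_col dotv_col_mx !dotvDr -!scalemxAl !dotvZr -!mulmxA.
  by rewrite ![dotv _ (_^T *m _)]dotv_mulmx !trmxK (dotvC (Gx *m b)); ring.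
have [u v|w v|B' [D' [BE DE psdF]]] := @psd_completion _ _ _ L%:M B C D L%:M symC.
(* Completing the square, the form equals L |z|^2 + 2 <z, Gx b> + L |Y b|^2 with z = u + X a. *)
- rewrite -[v]vsubmxK; set a := usubmx v; set b := dsubmx v.
  rewrite Cquad mul_scalar_mx mul_row_col dotvZr dotvDr -scalemxAl dotvZr.
  have := dotv_perturb_ge0 (u + X *m a) L0 (hGx b).
  rewrite !(dotvDl, dotvDr) (dotvC (X *m a) u); lra.
(* The same with z = w + Y b, Gy a and X a, once [XG] has turned <X a, Gx b> into <Gy a, Y b>. *)
- rewrite -[v]vsubmxK; set a := usubmx v; set b := dsubmx v.
  rewrite Cquad mul_scalar_mx tr_col_mx mul_row_col dotvZr dotvDr.
  rewrite linearZ /= !trmxK -scalemxAl dotvZr.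
  have := dotv_perturb_ge0 (w + Y *m b) L0 (hGy a).
  have -> : dotv (X *m a) (Gx *m b) = dotv (Gy *m a) (Y *m b).
    by rewrite dotv_mulmx [RHS]dotv_mulmx !mulmxA GX.
  rewrite !(dotvDl, dotvDr) (dotvC (Y *m b) w) (dotvC (Y *m b)); lra.
pose F := B' *m C *m D'; exists F.
have FY : F *m Y = Gx.
  have DY : D *m Y = C *m col_mx 0 1%:M.
    by rewrite mul_col_mx mul_block_col !mulmx0 !mulmx1 !add0r -scalemxAl XG.
  by rewrite /F -(mulmxA B') -DE -mulmxA DY mulmxA -BE mul_row_col mulmx0 add0r mulmx1.
have FX : F^T *m X = Gy.
  have XB : X^T *m B = row_mx 1%:M 0 *m C.
    by rewrite mul_mx_row mul_row_block !mul0mx !mul1mx !addr0 -scalemxAr.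
  rewrite -[LHS]trmxK trmx_mul trmxK /F -BE !mulmxA XB -mulmxA -DE.
  by rewrite mul_row_col mul0mx mul1mx addr0 trmxK.
(* The form is tested at u = - M w / L, which minimizes it over u when L > 0, and at u = - M w when
   L = 0. *)
have bound d e (M : 'M[R]_(d, e)) :
    (forall u w, 0 <= L * dotv u u + 2 * dotv u (M *m w) + L * dotv w w) ->
    forall w, dotv (M *m w) (M *m w) <= L ^+ 2 * dotv w w.
  move=> h w; set g := M *m w.
  move: (L0); rewrite le_eqVlt => /predU1P[L00|Lp].
    have := h (- g) w; rewrite -L00 !mul0r add0r addr0 dotvNl -/g expr0n mul0r.
    lra.
  have := h (- L^-1 *: g) w; rewrite -/g !(dotvZl, dotvZr).
  rewrite -(pmulr_rge0 _ Lp).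
  set a := dotv g g; set b := dotv w w.
  have -> : L * (L * (- L^-1 * (- L^-1 * a)) + 2 * (- L^-1 * a) + L * b) =
    L ^+ 2 * b - a by field; rewrite gt_eqF.
  by rewrite subr_ge0.
have psdF' u w : 0 <= L * dotv u u + 2 * dotv u (F *m w) + L * dotv w w.
  by have := psdF u w; rewrite !mul_scalar_mx !dotvZr.
split=> //; first exact: bound.
apply: bound => w u; have := psdF' u w.
by rewrite [dotv w (_ *m _)]dotv_mulmx trmxK (dotvC (F *m w)); lra.
Qed.

End Dot.

(** * Gradients of affine functions, and functions with constant gradient *)

Section Grad.
Variable R : realType.

Lemma differentiable_dotv d (g x : 'cV[R]_d) : differentiable (dotv g) x.
Proof.
have -> : dotv g = \sum_(k < d) (fun u : 'cV[R]_d => g k 0 * u k 0).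
  by apply/funext => u; rewrite fct_sumE.
apply: differentiable_sum => k.
apply: differentiableM; first exact: differentiable_cst.
exact: differentiable_coord.
Qed.

Lemma diff_dotv d (g x : 'cV[R]_d) : 'd (dotv g) x = dotv g :> (_ -> _).
Proof.
have lin : linear (dotv g : 'cV[R]_d -> R^o).
  by move=> a u v; rewrite dotvDr dotvZr.
pose linM := GRing.isLinear.Build _ _ _ _ _ lin.
pose L : {linear 'cV[R]_d -> R^o} := HB.pack (dotv g : _ -> R^o) linM.
apply: (@diff_lin _ _ _ L) => y.
exact/differentiable_continuous/differentiable_dotv.
Qed.

Lemma differentiable_affine d (g x : 'cV[R]_d) c :
  differentiable (fun u => dotv g u + c) x.
Proof. by apply: differentiableD; first exact: differentiable_dotv. Qed.

Lemma grad_affine d (g x : 'cV[R]_d) c : grad (fun u => dotv g u + c) x = g.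
Proof.
apply/matrixP => k j; rewrite ord1 mxE.
rewrite diffD; [|exact: differentiable_dotv|exact: differentiable_cst].
by rewrite diff_cst diff_dotv /= addr0 dotv_delta.
Qed.

Lemma strongly_convex_affine d (g : 'cV[R]_d) c :
  strongly_convex 0 (fun u => dotv g u + c).
Proof.
move=> t u v _ _; rewrite !mul0r !subr0.
rewrite /conv /= dotvDr !dotvZr /= le_eqVlt; apply/orP; left; apply/eqP.
rewrite [RHS](_ : _ = t%:num * (dotv g u + c) + (1 - t%:num) * (dotv g v + c)) //.
by rewrite /unstable.onem; ring.
Qed.

Lemma diff_gradE d (f : 'cV[R]_d -> R) (x v : 'cV[R]_d) :
  'd f x v = dotv (grad f x) v.
Proof.
rewrite [v in LHS]matrix_sum_delta linear_sum; apply: eq_bigr => k _.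
by rewrite big_ord1 linearZ mxE mulrC.
Qed.

(** Along the line through x0 and x, subtracting the expected linear growth from f leaves a function
    h of one real variable with zero derivative, so h 1 = h 0. *)
Lemma affine_of_const_grad d (f : 'cV[R]_d -> R) g :
  (forall x, differentiable f x) -> (forall x, grad f x = g) ->
  forall x0 x, f x = f x0 + dotv g (x - x0).
Proof.
move=> df gf x0 x; set v := x - x0.
pose h (t : R) := f (x0 + t *: v) - t * dotv g v.
have dl t : is_diff t (fun s : R => x0 + s *: v) ( *:%R ^~ v).
  by apply: is_diff_eq; rewrite add0r.
have : h 1 = h 0.
  apply: is_derive_0_is_cst => t.
  have dft : is_derive t 1 (fun s : R => f (x0 + s *: v)) (dotv g v).
    have dfl : differentiable (f \o (fun s : R => x0 + s *: v)) t.
      exact: differentiable_comp.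
    apply: DeriveDef; first exact: diff_derivable.
    rewrite deriveE // diff_comp //.
    by rewrite diff_val /= scale1r diff_gradE gf.
  have dgt : is_derive t 1 (fun s : R => s * dotv g v) (dotv g v).
    have -> : (fun s : R => s * dotv g v) = dotv g v \*: id.
      by apply/funext => s /=; rewrite mulrC.
    by apply: is_derive_eq; rewrite /GRing.scale /= mulr1.
  by apply: is_derive_eq; rewrite subrr.
rewrite /h scale1r scale0r addr0 mul1r mul0r subr0 => <-.
by rewrite subrK addrC subrK.
Qed.
End Grad.

(** * The saddle class with zero moduli consists of biaffine functions *)

Section Biaffine.
Variables (R : realType) (dx dy : nat).
Implicit Types (F : 'M[R]_(dx, dy)) (a x : 'cV[R]_dx) (b y : 'cV[R]_dy) (c : R).

(** F is the transpose of the matrix A in y^T A x. *)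
Definition biaffine F a b c x y : R :=
  dotv x (F *m y) + dotv a x + dotv b y + c.

Lemma biaffine_x F a b c y :
  (biaffine F a b c)^~ y = (fun u => dotv (F *m y + a) u + (dotv b y + c)).
Proof. by apply/funext => u; rewrite /biaffine dotvDl dotvC; ring. Qed.

Lemma biaffine_y F a b c x :
  biaffine F a b c x = (fun u => dotv (F^T *m x + b) u + (dotv a x + c)).
Proof. by apply/funext => u; rewrite /biaffine dotvDl dotv_mulmx; ring. Qed.

Lemma gradx_biaffine F a b c x y :
  gradx (biaffine F a b c) x y = F *m y + a.
Proof. by rewrite /gradx biaffine_x grad_affine. Qed.

Lemma grady_biaffine F a b c x y :
  grady (biaffine F a b c) x y = F^T *m x + b.
Proof. by rewrite /grady biaffine_y grad_affine. Qed.

Lemma biaffine_saddle L F a b c : 0 <= L ->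
  (forall w, dotv (F *m w) (F *m w) <= L ^+ 2 * dotv w w) ->
  (forall u, dotv (F^T *m u) (F^T *m u) <= L ^+ 2 * dotv u u) ->
  in_saddle_class 0 0 0 0 L (biaffine F a b c).
Proof.
move=> L0 hF hFT; split=> [y|x|x y|x y|x0 x1 y|x y0 y1|x y0 y1|x0 x1 y].
- by rewrite biaffine_x; exact: strongly_convex_affine.
- rewrite /strongly_concave biaffine_y.
  rewrite (_ : (fun _ => _) =
    (fun u => dotv (- (F^T *m x + b)) u - (dotv a x + c))).
    exact: strongly_convex_affine.
  by apply/funext => u; rewrite dotvNl opprD.
- by rewrite biaffine_x; exact: differentiable_affine.
- by rewrite biaffine_y; exact: differentiable_affine.
- by rewrite !gradx_biaffine subrr /norm2 dotv0 sqrtr0 mul0r.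
- by rewrite !grady_biaffine subrr /norm2 dotv0 sqrtr0 mul0r.
- by rewrite !gradx_biaffine opprD addrACA subrr addr0 -mulmxBr norm2_le.
- by rewrite !grady_biaffine opprD addrACA subrr addr0 -mulmxBr norm2_le.
Qed.

(** Each partial gradient is constant in its own variable, so f is affine in x and in y. Expanding f
    x y from the origin through (0, y) and through (x, 0) and comparing gives [GH], an adjointness
    that forces G and H to be linear and transposes of each other. *)
Lemma saddle_biaffine L f : 0 <= L -> in_saddle_class 0 0 0 0 L f ->
  exists F a b c, [/\ f = biaffine F a b c,
    forall w, dotv (F *m w) (F *m w) <= L ^+ 2 * dotv w w &
    forall u, dotv (F^T *m u) (F^T *m u) <= L ^+ 2 * dotv u u].
Proof.
move=> L0 [_ _ dfx dfy fxx fyy fxy fyx].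
have fx x0 x y : f x y = f x0 y + dotv (gradx f 0 y) (x - x0).
  apply: (@affine_of_const_grad _ _ (f^~ y) _ (dfx^~ y)) => {}x.
  by apply/eqP; rewrite -subr_eq0; apply/eqP/norm2_le0/fxx.
have fy x y0 y : f x y = f x y0 + dotv (grady f x 0) (y - y0).
  apply: (@affine_of_const_grad _ _ (f x) _ (dfy x)) => {}y.
  by apply/eqP; rewrite -subr_eq0; apply/eqP/norm2_le0/fyy.
pose G y := gradx f 0 y - gradx f 0 0; pose H x := grady f x 0 - grady f 0 0.
have GH x y : dotv (G y) x = dotv (H x) y.
  rewrite /G /H !dotvDl !dotvNl.
  have := fx 0 x y; have := fx 0 x 0; have := fy x 0 y; have := fy 0 0 y.
  rewrite !subr0 => -> -> -> /(canRL (addKr _)) ->.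
  by move: (f 0 0) (dotv _ _) (dotv _ _) (dotv _ _) => *; ring.
pose F := \matrix_(k, j) G (delta_mx j 0) k 0 : 'M[R]_(dx, dy).
(* By [GH], coordinate k of G y is the inner product of H e_k with y, hence linear in y. *)
have FG y : F *m y = G y.
  apply/matrixP => k j; rewrite ord1 -[RHS]dotv_delta GH mxE; apply: eq_bigr => l _.
  by rewrite mxE -[G _ k 0]dotv_delta GH dotv_delta.
have FH x : F^T *m x = H x.
  by apply: dotv_inj => y; rewrite -GH -FG dotvC [LHS]dotvC -dotv_mulmx dotvC.
exists F, (gradx f 0 0), (grady f 0 0), (f 0 0); split=> [|w|u].
- apply/funext => x; apply/funext => y; rewrite /biaffine FG dotvC GH.
  rewrite (fy x 0 y) (fx 0 x 0) /H dotvDl dotvNl !subr0; ring.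
(* The cross Lipschitz bound, taken between w and 0, is the bound on F w. *)
- by rewrite FG -norm2_le // -[in leRHS](subr0 w) fxy.
- by rewrite FH -norm2_le // -[in leRHS](subr0 u) fyx.
Qed.

End Biaffine.

(** * Centered data matrices and the interpolation theorem *)

Lemma centered_mx_affine (R : realType) d e (I : finType) (F : 'M[R]_(d, e)) a
    (z : I -> 'cV[R]_e) (w : I -> 'cV[R]_d) p :
  (forall i, w i = F *m z i + a) -> centered_mx w p = F *m centered_mx z p.
Proof.
move=> wz; apply/matrixP => k j; rewrite mxE !wz opprD addrACA subrr addr0 -mulmxBr !mxE.
by apply: eq_bigr => l _; rewrite [in RHS]mxE.
Qed.

Lemma col_centered_mx (R : realType) d (I : finType) (z : I -> 'cV[R]_d) p i :
  col (enum_rank i) (centered_mx z p) = z i - z p.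
Proof. by apply/matrixP => k j; rewrite ord1 2!mxE enum_rankK. Qed.

Lemma tr_centered_mulmx (R : realType) d (I : finType) (z w : I -> 'cV[R]_d) p
    i j : ((centered_mx z p)^T *m centered_mx w p) i j =
  dotv (z (enum_val i) - z p) (w (enum_val j) - w p).
Proof. by rewrite mxE; apply: eq_bigr => k _; rewrite !mxE. Qed.

Theorem theorem3p16 (R : realType) (dx dy : nat) (Lxy : R) (hL : 0 <= Lxy)
    (I : finType) (hI : (0 < #|I|)%N)
    (x : I -> 'cV[R]_dx) (y : I -> 'cV[R]_dy)
    (gx : I -> 'cV[R]_dx) (gy : I -> 'cV[R]_dy) (fv : I -> R) :
  interpolable (@saddle_class R dx dy 0 0 0 0 Lxy) x y gx gy fv <->
  (forall i j : I,
     fv i = fv j + dotv (gx j) (x i - x j) + dotv (gy i) (y i - y j)) /\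
  (forall p : I,
     let X := centered_mx x p in
     let Y := centered_mx y p in
     let Gx := centered_mx gx p in
     let Gy := centered_mx gy p in
     loewner_le (Gx^T *m Gx) (Lxy ^+ 2 *: (Y^T *m Y)) /\
     loewner_le (Gy^T *m Gy) (Lxy ^+ 2 *: (X^T *m X))).
Proof.
split=> [[f fS fI]|[fI]].
  have [F [a [b [c [fE hF hFT]]]]] := saddle_biaffine hL fS.
  have gxE i : gx i = F *m y i + a.
    by have [-> _ _] := fI i; rewrite fE gradx_biaffine.
  have gyE i : gy i = F^T *m x i + b.
    by have [_ -> _] := fI i; rewrite fE grady_biaffine.
  split=> [i j|p X Y Gx Gy].
    have [_ _ ->] := fI i; have [_ _ ->] := fI j; rewrite fE gxE gyE /biaffine.
    rewrite !(dotvDl, dotvDr, dotvNr) -!dotv_mulmx !(dotvC (F *m _)).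
    by ring.
  rewrite /Gx /Gy (centered_mx_affine _ gxE) (centered_mx_affine _ gyE).
  by split; apply/psd_gram => v; rewrite -!mulmxA.
(* Nonemptiness of I supplies the base point p. *)
move=> /(_ (enum_val (Ordinal hI))); set p := enum_val _.
move=> [/psd_gram hGx /psd_gram hGy].
(* Adding the value conditions at (i, p) and (p, j) and subtracting the one at (i, j) cancels all
   function values. The result is X^T Gx = Gy^T Y, entry by entry. *)
have cross i j :
    dotv (x i - x p) (gx j - gx p) = dotv (gy i - gy p) (y j - y p).
  have := fI i j; have := fI i p; have := fI p j.
  rewrite !(dotvDl, dotvDr, dotvNl, dotvNr) !(dotvC (x _)); lra.
have [|F [FY FX hF hFT]] := operator_interpolation hL _ hGx hGy.
  by apply/matrixP => i j; rewrite !tr_centered_mulmx cross.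
(* Column i of F Y = Gx reads F (y_i - y_p) = gx_i - gx_p, which dictates the constant term a. *)
have gxE i : gx i = F *m y i + (gx p - F *m y p).
  rewrite addrCA -mulmxBr -(col_centered_mx y p) colE mulmxA FY -colE.
  by rewrite col_centered_mx addrC subrK.
have gyE i : gy i = F^T *m x i + (gy p - F^T *m x p).
  rewrite addrCA -mulmxBr -(col_centered_mx x p) colE mulmxA FX -colE.
  by rewrite col_centered_mx addrC subrK.
set a := gx p - _ in gxE; set b := gy p - _ in gyE.
(* This c matches the value at p; the other values follow from the value condition between i and p,
   an identity that biaffine functions also satisfy. *)
pose c := fv p - biaffine F a b 0 (x p) (y p).
exists (biaffine F a b c); first exact: biaffine_saddle.
move=> i; split; rewrite ?gradx_biaffine ?grady_biaffine //.
rewrite (fI i p) /c /biaffine gxE gyE.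
rewrite !(dotvDl, dotvDr, dotvNr) -!dotv_mulmx !(dotvC (F *m _)).
by ring.
Qed.
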